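(* Let $\mathrm{pen}$ be a real-valued polyhedral gauge on $\mathbb{R}^p$ and let $\beta \in \mathbb{R}^p$. Then for every $s \in \mathrm{ri}(\partial_{\mathrm{pen}}(\beta))$ one has $C_\beta = \mathrm{ri}(N_{B^*}(s))$, and moreover $\mathrm{lin}(C_\beta) = \vec{\mathrm{aff}}(\partial_{\mathrm{pen}}(\beta))^\perp$.
   Context: A prime denotes transpose. A real-valued polyhedral gauge on $\mathbb{R}^p$ is a function of the form $\mathrm{pen}(b) = \max\{u_1'b,\dots,u_k'b\}$ for some $u_1,\dots,u_k \in \mathbb{R}^p$ with $u_1 = 0$. The associated polytope is $B^* = \mathrm{conv}(u_1,\dots,u_k)$ (it equals $\partial_{\mathrm{pen}}(0)$). For convex $\phi:\mathbb{R}^p\to\mathbb{R}$, $\partial_\phi(\beta) = \{s : \phi(b) \ge \phi(\beta) + s'(b-\beta)\ \forall b \in \mathbb{R}^p\}$ is the subdifferential. Two vectors $\beta,\tilde\beta \in \mathbb{R}^p$ have the same pattern with respect to $\mathrm{pen}$ if $\partial_{\mathrm{pen}}(\beta) = \partial_{\mathrm{pen}}(\tilde\beta)$; the pattern equivalence class of $\beta$ is $C_\beta = \{b \in \mathbb{R}^p : \partial_{\mathrm{pen}}(b) = \partial_{\mathrm{pen}}(\beta)\}$. For a closed convex set $K$ and $s \in K$, the normal cone is $N_K(s) = \{v \in \mathbb{R}^p : v'(b-s) \le 0\ \forall b \in K\}$. $\mathrm{ri}$ is the relative interior, $\mathrm{lin}(S)$ the linear span of $S$, $\mathrm{aff}(S)$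 the affine hull, and $\vec{\mathrm{aff}}(S)$ the linear subspace parallel to $\mathrm{aff}(S)$; $\perp$ denotes orthogonal complement. *)

(* Defs.v *)
From mathcomp Require Import all_boot all_order all_algebra.
From mathcomp Require Import all_classical all_reals all_analysis.

Set Implicit Arguments.
Unset Strict Implicit.
Unset Printing Implicit Defensive.

Import Order.TTheory GRing.Theory Num.Theory.
Import numFieldNormedType.Exports.

Local Open Scope classical_set_scope.
Local Open Scope ring_scope.

Definition dot (R : realType) (p : nat) (u v : 'cV[R]_p) : R :=
  (u^T *m v) 0 0.

Definition lin_span (R : realType) (p : nat) (S : set 'cV[R]_p) :
    set 'cV[R]_p :=
  [set y | exists (n : nat) (a : 'I_n -> R) (x : 'I_n -> 'cV[R]_p),
     (forall i, S (x i)) /\ y = \sum_(i < n) a i *: x i].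

Definition aff_hull (R : realType) (p : nat) (S : set 'cV[R]_p) :
    set 'cV[R]_p :=
  [set y | exists (n : nat) (a : 'I_n -> R) (x : 'I_n -> 'cV[R]_p),
     [/\ forall i, S (x i), \sum_(i < n) a i = 1
       & y = \sum_(i < n) a i *: x i]].

Definition conv_hull (R : realType) (p : nat) (S : set 'cV[R]_p) :
    set 'cV[R]_p :=
  [set y | exists (n : nat) (a : 'I_n -> R) (x : 'I_n -> 'cV[R]_p),
     [/\ forall i, S (x i), forall i, 0 <= a i, \sum_(i < n) a i = 1
       & y = \sum_(i < n) a i *: x i]].

(* The differences of points of a nonempty affine subspace form the linear
   subspace parallel to it. *)
Definition aff_dir (R : realType) (p : nat) (S : set 'cV[R]_p) :
    set 'cV[R]_p :=
  [set z | exists x y : 'cV[R]_p,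
     [/\ aff_hull S x, aff_hull S y & z = x - y]].

Definition orthocomp (R : realType) (p : nat) (S : set 'cV[R]_p) :
    set 'cV[R]_p :=
  [set v | forall w, S w -> dot v w = 0].

(* The topology of 'cV[R]_p is that of entrywise convergence, i.e. the usual
   one of R^p. *)
Definition rel_interior (R : realType) (p : nat) (S : set 'cV[R]_p) :
    set 'cV[R]_p :=
  [set x | S x /\ \forall y \near x, aff_hull S y -> S y].

Definition subdifferential (R : realType) (p : nat) (phi : 'cV[R]_p -> R)
    (beta : 'cV[R]_p) : set 'cV[R]_p :=
  [set s | forall b, phi beta + dot s (b - beta) <= phi b].

Definition pattern_class (R : realType) (p : nat) (pen : 'cV[R]_p -> R)
    (beta : 'cV[R]_p) : set 'cV[R]_p :=
  [set b | subdifferential pen b = subdifferential pen beta].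

Definition normal_cone (R : realType) (p : nat) (K : set 'cV[R]_p)
    (s : 'cV[R]_p) : set 'cV[R]_p :=
  [set v | forall b, K b -> dot v (b - s) <= 0].

(* [\big[op/x]] needs an initial value; taking one of the terms of the maximum
   makes it harmless, whatever the sign of the other terms. *)
Definition max_linear (R : realType) (p k : nat) (u : 'I_k.+1 -> 'cV[R]_p)
    (b : 'cV[R]_p) : R :=
  \big[Num.max/dot (u ord0) b]_(i < k.+1) dot (u i) b.

(* Main.v *)
Require Import Defs.
From mathcomp Require Import all_boot all_order all_algebra.
From mathcomp Require Import all_classical all_reals all_analysis.
From mathcomp Require Import ring lra.

Set Implicit Arguments.
Unset Strict Implicit.
Unset Printing Implicit Defensive.

Import Order.TTheory GRing.Theory Num.Theory.
Import numFieldNormedType.Exports.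

Local Open Scope classical_set_scope.
Local Open Scope ring_scope.

(** A maximum of linear forms is positively homogeneous, so [s] is a
    subgradient of [pen] at [v] exactly when the linear form [s] lies below
    [pen] everywhere and touches it at [v] ([subdifferential_homogP]). On the
    other side, [v] is normal to [conv(u)] at [s] exactly when [pen v <= s'v].
    Hence, for a form [s] below [pen], the normal cone at [s] is
    [{v | s is a subgradient of pen at v}] ([normal_cone_subdifferentialP]), and
    both sides of the theorem are statements about which forms touch [pen]
    where.

    A point of the relative interior of a set can be pushed slightly beyond
    itself, away from any other point of the set ([rel_interior_extend]). If
    [v] is in the relative interior of the normal cone, pushing [v] away from
    [beta] turns a form that touches at [v] into one that touches at [beta];
    pushing [s] away from [t] turns a form [t] that touches at [beta] into one
    that touches wherever [s] does, in particular at [v]. So [v] and [beta] have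
    the same subdifferential. Conversely, near a point [v] only the forms [u i]
    active at [v] can be active ([near_active]). If [v] has the pattern of
    [beta], these are subgradients at [beta], hence agree with [s] on the normal
    cone and on its affine hull; so [s] touches [pen] at all points of that hull
    close to [v], which puts [v] in the relative interior.

    For the span, all subgradients at a point [v] of the class take the same
    value at [v], so [v] is orthogonal to their differences. Conversely, if [w]
    is orthogonal to these differences, then the forms active at [beta] take a
    common value at [w], so [pen] is affine along [w] near [beta]
    ([max_linear_affine_along]); thus [beta + e *: w] has the pattern of [beta]
    for small [e > 0], and [w] is a multiple of the difference of two points of
    the class. *)

(** * The scalar product *)

Lemma dotE (R : realType) (p : nat) (x y : 'cV[R]_p) :
  dot x y = \sum_j x j 0 * y j 0.
Proof. by rewrite /dot mxE; apply: eq_bigr => j _; rewrite mxE. Qed.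

Lemma dotC (R : realType) (p : nat) (x y : 'cV[R]_p) : dot x y = dot y x.
Proof. by rewrite !dotE; apply: eq_bigr => j _; rewrite mulrC. Qed.

Lemma dotDr (R : realType) (p : nat) (x y z : 'cV[R]_p) :
  dot x (y + z) = dot x y + dot x z.
Proof. by rewrite /dot mulmxDr mxE. Qed.

Lemma dotZr (R : realType) (p : nat) (a : R) (x y : 'cV[R]_p) :
  dot x (a *: y) = a * dot x y.
Proof. by rewrite /dot -scalemxAr mxE. Qed.

Lemma dotBr (R : realType) (p : nat) (x y z : 'cV[R]_p) :
  dot x (y - z) = dot x y - dot x z.
Proof. by rewrite -scaleN1r dotDr dotZr mulN1r. Qed.

Lemma dotDl (R : realType) (p : nat) (x y z : 'cV[R]_p) :
  dot (x + y) z = dot x z + dot y z.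
Proof. by rewrite dotC dotDr !(dotC z). Qed.

Lemma dotZl (R : realType) (p : nat) (a : R) (x y : 'cV[R]_p) :
  dot (a *: x) y = a * dot x y.
Proof. by rewrite dotC dotZr dotC. Qed.

Lemma dotBl (R : realType) (p : nat) (x y z : 'cV[R]_p) :
  dot (x - y) z = dot x z - dot y z.
Proof. by rewrite dotC dotBr !(dotC z). Qed.

Definition dot_lin := (dotBl, dotDl, dotZl, dotBr, dotDr, dotZr).

Lemma dot_sumr (R : realType) (p n : nat) (v : 'cV[R]_p) (a : 'I_n -> R)
    (x : 'I_n -> 'cV[R]_p) :
  dot v (\sum_(i < n) a i *: x i) = \sum_(i < n) a i * dot v (x i).
Proof.
by rewrite /dot mulmx_sumr summxE; apply: eq_bigr => i _; rewrite -dotZr.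
Qed.

Lemma dot_continuous (R : realType) (p : nat) (x : 'cV[R]_p) :
  continuous (dot x).
Proof.
have -> : dot x = \sum_j (fun z : 'cV[R]_p => x j 0 * z j 0).
  by apply/funext => z; rewrite dotE fct_sumE.
elim/big_ind: _ => [y|f g cf cg y|j _ y].
- exact: cst_continuous.
- by apply: (cvgD (cf y) (cg y)).
- by apply: continuousM; [exact: cst_continuous|exact: coord_continuous].
Qed.

(** * Hulls and relative interiors *)

Lemma dot_aff_hull_const (R : realType) (p : nat) (S : set 'cV[R]_p)
    (v : 'cV[R]_p) (c : R) :
  (forall x, S x -> dot v x = c) -> forall y, aff_hull S y -> dot v y = c.
Proof.
move=> vS y [n [a [x [Sx a1 ->]]]]; rewrite dot_sumr.
under eq_bigr => i _ do rewrite vS //.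
by rewrite -mulr_suml a1 mul1r.
Qed.

Lemma dot_conv_hull_le (R : realType) (p : nat) (S : set 'cV[R]_p)
    (v : 'cV[R]_p) (c : R) :
  (forall x, S x -> dot v x <= c) -> forall y, conv_hull S y -> dot v y <= c.
Proof.
move=> vS y [n [a [x [Sx a0 a1 ->]]]]; rewrite dot_sumr.
rewrite -[c]mul1r -a1 mulr_suml; apply: ler_sum => i _.
by apply: ler_wpM2l => //; exact: vS.
Qed.

Lemma subset_conv_hull (R : realType) (p : nat) (S : set 'cV[R]_p) :
  S `<=` conv_hull S.
Proof.
move=> x Sx; exists 1%N, (fun=> 1), (fun=> x).
by split=> //; rewrite big_ord1 ?scale1r.
Qed.

Lemma subset_aff_hull (R : realType) (p : nat) (S : set 'cV[R]_p) :
  S `<=` aff_hull S.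
Proof.
move=> x Sx; exists 1%N, (fun=> 1), (fun=> x).
by split=> //; rewrite big_ord1 ?scale1r.
Qed.

Lemma aff_hull_line (R : realType) (p : nat) (S : set 'cV[R]_p)
    (x t : 'cV[R]_p) (e : R) :
  S x -> S t -> aff_hull S (x + e *: (x - t)).
Proof.
move=> Sx St.
exists 2%N, (fun i => if i == ord0 then 1 + e else - e),
  (fun i => if i == ord0 then x else t).
split; first by move=> i; case: ifP.
  by rewrite big_ord_recl big_ord1 /=; ring.
rewrite big_ord_recl big_ord1 /= scalerDl scale1r scalerBr scaleNr.
by rewrite addrA.
Qed.

Lemma line_near (R : realType) (p : nat) (x d : 'cV[R]_p)
    (P : set 'cV[R]_p) :
  (\forall y \near x, P y) -> \forall e \near (0 : R)^'+, P (x + e *: d).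
Proof.
move=> Px.
have cvg : x + e *: d @[e --> (0 : R)] --> x.
  rewrite -[X in _ --> X]addr0 -(scale0r d).
  by apply: cvgD; [exact: cvg_cst|apply: cvgZl; exact: cvg_id].
by apply: cvg_within; exact: cvg Px.
Qed.

Lemma rel_interior_extend (R : realType) (p : nat) (S : set 'cV[R]_p)
    (x t : 'cV[R]_p) :
  rel_interior S x -> S t -> exists2 e : R, 0 < e & S (x + e *: (x - t)).
Proof.
move=> [Sx nearS] St.
have nearL := line_near (x - t) nearS.
have [e [e0 Se]] := filter_ex (filterI (nbhs_right_gt (0 : R)) nearL).
by exists e => //; apply: Se; exact: aff_hull_line.
Qed.

(** * Maxima of linear forms *)

Lemma max_linear_ge (R : realType) (p k : nat) (u : 'I_k.+1 -> 'cV[R]_p)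
    (b : 'cV[R]_p) (i : 'I_k.+1) : dot (u i) b <= max_linear u b.
Proof. exact: (le_bigmax _ (fun j => dot (u j) b)). Qed.

Lemma max_linear_attained (R : realType) (p k : nat)
    (u : 'I_k.+1 -> 'cV[R]_p) (b : 'cV[R]_p) :
  exists i, max_linear u b = dot (u i) b.
Proof.
rewrite /max_linear; elim/big_ind: _ => [|x y [i ->] [j ->]|i _].
- by exists ord0.
- by case: (leP (dot (u i) b) (dot (u j) b)); [exists j|exists i].
- by exists i.
Qed.

Lemma max_linear_leP (R : realType) (p k : nat) (u : 'I_k.+1 -> 'cV[R]_p)
    (b : 'cV[R]_p) (c : R) :
  (forall i, dot (u i) b <= c) <-> max_linear u b <= c.
Proof.
split=> [uc|uc i]; last exact: le_trans (max_linear_ge u b i) uc.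
by have [i ->] := max_linear_attained u b.
Qed.

Lemma max_linearZ (R : realType) (p k : nat) (u : 'I_k.+1 -> 'cV[R]_p)
    (a : R) (b : 'cV[R]_p) :
  0 <= a -> max_linear u (a *: b) = a * max_linear u b.
Proof.
move=> a0; apply/eqP; rewrite eq_le; apply/andP; split.
  apply/max_linear_leP => i; rewrite dotZr.
  by apply: ler_wpM2l => //; exact: max_linear_ge.
have [i ->] := max_linear_attained u b.
by rewrite -dotZr; exact: max_linear_ge.
Qed.

(** Finitely many strict inequalities between continuous functions persist
    nearby, so a form that is not active at [b] stays inactive close to [b]. *)
Lemma near_active (R : realType) (p k : nat) (u : 'I_k.+1 -> 'cV[R]_p)
    (b : 'cV[R]_p) :
  \forall y \near b, forall i,
    max_linear u y = dot (u i) y -> max_linear u b = dot (u i) b.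
Proof.
apply: (@filter_forall _ _ (fun i y => max_linear u y = dot (u i) y ->
  max_linear u b = dot (u i) b) (nbhs b)) => i.
have [j jb] := max_linear_attained u b.
have [ib|ib] := eqVneq (max_linear u b) (dot (u i) b).
  by apply: nearW.
have ltij : 0 < dot (u j - u i) b.
  by rewrite dotBl -jb subr_gt0 lt_neqAle eq_sym ib max_linear_ge.
have near_gt : \forall y \near b, 0 < dot (u j - u i) y.
  by apply: (@cvgr_gt _ _ (nbhs b)) ltij; exact: dot_continuous.
apply: (@filterS _ (nbhs b)) near_gt => y; rewrite dotBl subr_gt0 => ltij_y iy.
by have := max_linear_ge u y j; rewrite iy leNgt ltij_y.
Qed.

(** The slope is [c] for every form active at [b], and no other form is active
    close to [b]. *)
Lemma max_linear_affine_along (R : realType) (p k : nat)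
    (u : 'I_k.+1 -> 'cV[R]_p) (b w : 'cV[R]_p) (c : R) :
  (forall i, max_linear u b = dot (u i) b -> dot (u i) w = c) ->
  \forall e \near (0 : R)^'+,
    max_linear u (b + e *: w) = max_linear u b + e * c.
Proof.
move=> uc; apply: filterS (line_near w (near_active u b)).
move=> e act; have [i iy] := max_linear_attained u (b + e *: w).
by rewrite iy !dot_lin (act i iy) uc //; exact: act.
Qed.

(** * Subgradients and normal cones *)

(** Comparing with the points [0] and [2 *: b] of the ray through [b] forces
    equality at [b], and then the inequality loses its constant terms. *)
Lemma subdifferential_homogP (R : realType) (p : nat) (phi : 'cV[R]_p -> R)
    (b s : 'cV[R]_p) :
  (forall (a : R) (x : 'cV[R]_p), 0 <= a -> phi (a *: x) = a * phi x) ->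
  subdifferential phi b s <->
  (forall x, dot s x <= phi x) /\ dot s b = phi b.
Proof.
move=> homog; split=> [sub|[le_s eq_s] x]; last first.
  by rewrite dotBr eq_s addrC subrK.
have eq_s : dot s b = phi b.
  have := sub (0 *: b); rewrite homog // !dot_lin => h0.
  by have := sub (2 *: b); rewrite homog // !dot_lin => h2; lra.
by split=> // x; have := sub x; rewrite dotBr eq_s addrC subrK.
Qed.

Lemma subdifferential_max_linearP (R : realType) (p k : nat)
    (u : 'I_k.+1 -> 'cV[R]_p) (b s : 'cV[R]_p) :
  subdifferential (max_linear u) b s <->
  (forall x, dot s x <= max_linear u x) /\ dot s b = max_linear u b.
Proof. by apply: subdifferential_homogP => a x; exact: max_linearZ. Qed.

Lemma active_subdifferential (R : realType) (p k : nat)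
    (u : 'I_k.+1 -> 'cV[R]_p) (b : 'cV[R]_p) (i : 'I_k.+1) :
  max_linear u b = dot (u i) b -> subdifferential (max_linear u) b (u i).
Proof.
move=> ib; apply/subdifferential_max_linearP; split=> // x.
exact: max_linear_ge.
Qed.

Lemma normal_cone_conv_hullP (R : realType) (p k : nat)
    (u : 'I_k.+1 -> 'cV[R]_p) (s v : 'cV[R]_p) :
  normal_cone (conv_hull (range u)) s v <-> max_linear u v <= dot s v.
Proof.
split=> [Nv|/max_linear_leP le_v x].
  apply/max_linear_leP => i; rewrite dotC (dotC s) -subr_le0 -dotBr.
  by apply: Nv; apply: subset_conv_hull; exists i.
rewrite dotBr subr_le0; apply: dot_conv_hull_le => _ [i _ <-].
by rewrite dotC (dotC v).
Qed.

(** The duality between normal cones and faces, read on linear forms: below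
    [max_linear u], the inequality of [normal_cone_conv_hullP] can only hold as
    an equality, which says that [s] touches at [v]. *)
Lemma normal_cone_subdifferentialP (R : realType) (p k : nat)
    (u : 'I_k.+1 -> 'cV[R]_p) (s v : 'cV[R]_p) :
  (forall x, dot s x <= max_linear u x) ->
  normal_cone (conv_hull (range u)) s v <->
  subdifferential (max_linear u) v s.
Proof.
move=> le_s; split=> [/normal_cone_conv_hullP le_v|].
  apply/subdifferential_max_linearP; split=> //.
  by apply/eqP; rewrite eq_le le_s.
move=> /subdifferential_max_linearP[_ eq_v].
by apply/normal_cone_conv_hullP; rewrite eq_v.
Qed.

(** Pushing [s] away from [t] inside the subdifferential at [b] gives another
    form below [max_linear u]; at [v], where [s] touches, this bounds [t] from
    below by [s]. *)
Lemma subdifferential_rel_interior_sub (R : realType) (p k : nat)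
    (u : 'I_k.+1 -> 'cV[R]_p) (b v s : 'cV[R]_p) :
  rel_interior (subdifferential (max_linear u) b) s ->
  subdifferential (max_linear u) v s ->
  subdifferential (max_linear u) b `<=` subdifferential (max_linear u) v.
Proof.
move=> ri_s /subdifferential_max_linearP[_ sv] t bt.
have [e e0] := rel_interior_extend ri_s bt.
move=> /subdifferential_max_linearP[/(_ v) push _].
have [le_t _] := (subdifferential_max_linearP _ _ _).1 bt.
apply/subdifferential_max_linearP; split=> //.
apply/eqP; rewrite eq_le le_t /= -sv -subr_le0 -(pmulr_rle0 _ e0).
by move: push; rewrite !dot_lin -sv gerDl.
Qed.

(** Pushing [v] away from [b] inside the normal cone keeps [s] touching; a form
    [t] that touches at [v] lies below [s] at the new point, hence above [s]
    at [b]. *)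
Lemma subdifferential_normal_cone_sub (R : realType) (p k : nat)
    (u : 'I_k.+1 -> 'cV[R]_p) (b v s : 'cV[R]_p) :
  subdifferential (max_linear u) b s ->
  rel_interior (normal_cone (conv_hull (range u)) s) v ->
  subdifferential (max_linear u) v `<=` subdifferential (max_linear u) b.
Proof.
move=> bs ri_v t /subdifferential_max_linearP[le_t tv].
have [le_s sb] := (subdifferential_max_linearP _ _ _).1 bs.
have NP x := normal_cone_subdifferentialP x le_s.
have /NP/subdifferential_max_linearP[_ sv] := ri_v.1.
have [e e0] := rel_interior_extend ri_v ((NP b).2 bs).
move=> /NP/subdifferential_max_linearP[_ push].
apply/subdifferential_max_linearP; split=> //.
apply/eqP; rewrite eq_le le_t /= -sb -subr_ge0 -(pmulr_rge0 _ e0).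
have := le_t (v + e *: (v - b)); rewrite -push !dot_lin tv sv; lra.
Qed.

(** Close to [v] the active forms are active at [v], hence subgradients at [b].
    By [subdifferential_rel_interior_sub] they agree with [s] on the normal cone
    and therefore on its affine hull. *)
Lemma pattern_class_rel_interior (R : realType) (p k : nat)
    (u : 'I_k.+1 -> 'cV[R]_p) (b v s : 'cV[R]_p) :
  rel_interior (subdifferential (max_linear u) b) s ->
  pattern_class (max_linear u) b v ->
  rel_interior (normal_cone (conv_hull (range u)) s) v.
Proof.
move=> ri_s vb.
have [le_s _] := (subdifferential_max_linearP _ _ _).1 ri_s.1.
have NP x := normal_cone_subdifferentialP x le_s.
split; first by apply/NP; rewrite vb; exact: ri_s.1.
apply: (@filterS _ (nbhs v)) (near_active u v) => y act aff_y.
have [i iy] := max_linear_attained u y.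
have bi : subdifferential (max_linear u) b (u i).
  by rewrite -vb; apply: active_subdifferential; exact: act.
have agree x : normal_cone (conv_hull (range u)) s x -> dot (u i - s) x = 0.
  move=> /NP sx; move: (sx) => /subdifferential_max_linearP[_ eq_s].
  have := subdifferential_rel_interior_sub ri_s sx bi.
  by move=> /subdifferential_max_linearP[_ eq_i]; rewrite dotBl eq_i eq_s subrr.
apply/normal_cone_conv_hullP; rewrite iy -subr_le0 -dotBl.
by rewrite (dot_aff_hull_const agree aff_y).
Qed.

Lemma pattern_class_normal_cone (R : realType) (p k : nat)
    (u : 'I_k.+1 -> 'cV[R]_p) (b s : 'cV[R]_p) :
  rel_interior (subdifferential (max_linear u) b) s ->
  pattern_class (max_linear u) b =
  rel_interior (normal_cone (conv_hull (range u)) s).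
Proof.
move=> ri_s; apply/seteqP; split=> v.
  exact: pattern_class_rel_interior.
move=> ri_v; apply/seteqP; split.
  exact: subdifferential_normal_cone_sub ri_s.1 ri_v.
apply: (subdifferential_rel_interior_sub ri_s).
have [le_s _] := (subdifferential_max_linearP _ _ _).1 ri_s.1.
by apply/(normal_cone_subdifferentialP _ le_s); exact: ri_v.1.
Qed.

(** * The span of a pattern class *)

Lemma pattern_class_orthocomp (R : realType) (p k : nat)
    (u : 'I_k.+1 -> 'cV[R]_p) (b v : 'cV[R]_p) :
  pattern_class (max_linear u) b v ->
  orthocomp (aff_dir (subdifferential (max_linear u) b)) v.
Proof.
move=> vb _ [x [y [affx affy ->]]]; rewrite dotBr.
have const t : subdifferential (max_linear u) b t -> dot v t = max_linear u v.
  by rewrite -vb => /subdifferential_max_linearP[_]; rewrite dotC.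
by rewrite !(dot_aff_hull_const const) // subrr.
Qed.

(** Subgradients at [b] and at [b + e *: w] are compared through the values of
    [max_linear u] at [b + e *: w] and at the point [b + e *: (2 *: w)] beyond
    it. *)
Lemma pattern_class_perturb (R : realType) (p k : nat)
    (u : 'I_k.+1 -> 'cV[R]_p) (b w : 'cV[R]_p) :
  orthocomp (aff_dir (subdifferential (max_linear u) b)) w ->
  exists2 e : R, 0 < e & pattern_class (max_linear u) b (b + e *: w).
Proof.
move=> orth; have [i0 i0b] := max_linear_attained u b.
have const t : subdifferential (max_linear u) b t -> dot t w = dot (u i0) w.
  move=> bt; apply/eqP; rewrite -subr_eq0 -dotBl dotC; apply/eqP.
  apply: orth; exists t, (u i0); split=> //; apply: subset_aff_hull => //.
  exact: active_subdifferential.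
have act i : max_linear u b = dot (u i) b -> dot (u i) w = dot (u i0) w.
  by move=> ib; apply: const; exact: active_subdifferential.
have affine1 := max_linear_affine_along act.
have affine2 : \forall e \near (0 : R)^'+, max_linear u (b + e *: (2 *: w)) =
    max_linear u b + e * (2 * dot (u i0) w).
  by apply: max_linear_affine_along => i /act; rewrite dotZr => ->.
have [e [e0 [aff1 aff2]]] :=
  filter_ex (filterI (nbhs_right_gt (0 : R)) (filterI affine1 affine2)).
exists e => //; apply/seteqP; split=> t.
  move=> /subdifferential_max_linearP[le_t eq_t].
  apply/subdifferential_max_linearP; split=> //.
  apply/eqP; rewrite eq_le le_t /=.
  have := le_t (b + e *: (2 *: w)).
  by move: eq_t; rewrite aff1 aff2 !dot_lin; lra.
move=> bt; have /subdifferential_max_linearP[le_t eq_t] := bt.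
apply/subdifferential_max_linearP; split=> //.
by rewrite aff1 !dot_lin eq_t const.
Qed.

Theorem theorem3p2 (R : realType) (p k : nat) (u : 'I_k.+1 -> 'cV[R]_p)
    (pen : 'cV[R]_p -> R) (hu : u ord0 = 0)
    (hpen : forall b : 'cV[R]_p, pen b = max_linear u b)
    (beta : 'cV[R]_p) :
  (forall s : 'cV[R]_p, rel_interior (subdifferential pen beta) s ->
     pattern_class pen beta =
     rel_interior (normal_cone (conv_hull (range u)) s)) /\
  lin_span (pattern_class pen beta) =
    orthocomp (aff_dir (subdifferential pen beta)).
Proof.
have {hpen} -> : pen = max_linear u by apply/funext.
split; first by move=> s; exact: pattern_class_normal_cone.
apply/seteqP; split=> w.
  move=> [n [a [x [xC ->]]]] z dz; rewrite dotC dot_sumr big1 // => i _.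
  by rewrite dotC (pattern_class_orthocomp (xC i)) ?mulr0.
move=> /pattern_class_perturb[e e0 pert].
exists 2%N, (fun i => if i == ord0 then e^-1 else - e^-1),
  (fun i => if i == ord0 then beta + e *: w else beta).
split; first by move=> i; case: ifP.
rewrite big_ord_recl big_ord1 /= scalerDr scalerA mulVf ?gt_eqF //.
by rewrite scale1r scaleNr addrAC subrr add0r.
Qed.
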